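(* Let $J\in\mathbb{C}^{n\times n}$ be the $n\times n$ Jordan block with eigenvalue $0$ (ones on the first superdiagonal, zeros elsewhere). Let $E\in\mathbb{C}^{n\times n}$ be of the form $E=JB-BJ$ for some $B\in\mathbb{C}^{n\times n}$; equivalently, the entries of $E$ on each subdiagonal (including the main diagonal) sum to zero. If $$\sum_{r=1}^{n-1}(-1)^rE(n,r+1)\,E(r,1)\neq0,$$ then the perturbation of the eigenvalues of $J+\varepsilon E$ has order $\mathcal{O}(\varepsilon^{2/n})$ as $\varepsilon\to0$; that is, the eigenvalues $\lambda(\varepsilon)$ of $J+\varepsilon E$ satisfy $|\lambda(\varepsilon)-0|=\mathcal{O}(|\varepsilon|^{2/n})$.
   Context: $E(i,j)$ denotes the $(i,j)$ entry of $E$. The $k$-th subdiagonal of $E$ ($0\le k\le n-1$) consists of the entries $E(j+k,j)$, $1\le j\le n-k$; $k=0$ is the main diagonal. *)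

(* Defs.v *)
From mathcomp Require Import all_boot all_order all_algebra.
From mathcomp Require Import complex.
From mathcomp Require Import all_classical all_reals all_analysis.

Set Implicit Arguments.
Unset Strict Implicit.
Unset Printing Implicit Defensive.

Import Order.TTheory GRing.Theory Num.Theory.
Import numFieldNormedType.Exports.

Local Open Scope ring_scope.

Section Matrices.
Variables (K : fieldType) (N : nat).

Definition jordan0 : 'M[K]_N := \matrix_(i, j) (j == i.+1 :> nat)%:R.

(* Indices of [entry] start at 1; it is meaningful only for 1 <= i, j <= N + 1,
   since [inord] sends out-of-range indices to 0. *)
Definition entry (E : 'M[K]_N.+1) (i j : nat) : K :=
  E (inord i.-1) (inord j.-1).

Definition subdiag_sum (E : 'M[K]_N.+1) (k : nat) : K :=
  \sum_(1 <= j < (N.+1 - k).+1) entry E (j + k) j.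

End Matrices.

(* The norm `|z| has type R[i] (with zero imaginary part); [cmod z] is the
   modulus as an element of R. *)
Definition cmod (R : realType) (z : R[i]) : R := complex.Re `|z|.

(* Main.v *)
Require Import Defs.
From mathcomp Require Import all_boot all_order all_algebra.
From mathcomp Require Import complex ring.
From mathcomp Require Import all_classical all_reals all_analysis.

Set Implicit Arguments.
Unset Strict Implicit.
Unset Printing Implicit Defensive.

Import Order.TTheory GRing.Theory Num.Theory.
Import numFieldNormedType.Exports.

Local Open Scope classical_set_scope.
Local Open Scope complex_scope.
Local Open Scope ring_scope.

(* The entry (i, j) of JB - BJ is B(i+1, j) - B(i, j-1), so the sums along
   subdiagonals telescope; conversely B is recovered by summing E along
   diagonals, the last row of the equation being the vanishing of these sums.

   If E = JB - BJ, conjugation by I - eps B turns J + eps E into J + O(eps^2):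
   a left eigenvector v for lambda gives w = v (I - eps B), of size comparable
   to v, with w (lambda - J) = O(eps^2) |w|. Multiplying by
   sum_i lambda^(n-1-i) J^i and using J^n = 0 gives lambda^n w = O(eps^2) |w|. *)

(** * The entrywise sum norm on rectangular matrices *)

Section EntrySumNorm.
Variable K : numFieldType.
Implicit Types m n p : nat.

(** Row vectors and square matrices share this one norm, so [v *m A] is bounded by plain
    submultiplicativity. Values stay in [K], which later is [R[i]]. *)
Definition mxnorm1 m n (A : 'M[K]_(m, n)) : K := \sum_i \sum_j `|A i j|.

Lemma mxnorm1_ge0 m n (A : 'M[K]_(m, n)) : 0 <= mxnorm1 A.
Proof. by apply: sumr_ge0 => i _; apply: sumr_ge0. Qed.

Lemma mxnorm1_eq0 m n (A : 'M[K]_(m, n)) : (mxnorm1 A == 0) = (A == 0).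
Proof.
apply/eqP/eqP => [A0|->]; last first.
  by rewrite /mxnorm1 big1// => i _; rewrite big1// => j _; rewrite mxE normr0.
apply/matrixP => i j; rewrite mxE; apply/eqP; rewrite -normr_eq0.
have /psumr_eq0P Ai0 : \sum_j `|A i j| = 0.
  by move/psumr_eq0P: A0; apply => // k _; apply: sumr_ge0.
by rewrite Ai0.
Qed.

Lemma mxnorm1D m n (A B : 'M[K]_(m, n)) :
  mxnorm1 (A + B) <= mxnorm1 A + mxnorm1 B.
Proof.
rewrite -big_split; apply: ler_sum => i _ /=.
by rewrite -big_split; apply: ler_sum => j _; rewrite mxE ler_normD.
Qed.

Lemma mxnorm1Z m n (a : K) (A : 'M[K]_(m, n)) :
  mxnorm1 (a *: A) = `|a| * mxnorm1 A.
Proof.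
rewrite mulr_sumr; apply: eq_bigr => i _; rewrite mulr_sumr.
by apply: eq_bigr => j _; rewrite mxE normrM.
Qed.

Lemma mxnorm1_sum (I : finType) m n (F : I -> 'M[K]_(m, n)) :
  mxnorm1 (\sum_i F i) <= \sum_i mxnorm1 (F i).
Proof.
elim/big_rec2: _ => [|i y z _ h].
  by have /eqP-> : mxnorm1 (0 : 'M[K]_(m, n)) == 0 by rewrite mxnorm1_eq0.
by apply: le_trans (mxnorm1D _ _) _; rewrite lerD2l.
Qed.

Lemma mxnorm1M m n p (A : 'M[K]_(m, n)) (B : 'M[K]_(n, p)) :
  mxnorm1 (A *m B) <= mxnorm1 A * mxnorm1 B.
Proof.
rewrite mulr_suml; apply: ler_sum => i _.
apply: (@le_trans _ _ (\sum_j \sum_k `|A i k| * `|B k j|)).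
  apply: ler_sum => j _; rewrite mxE; apply: le_trans (ler_norm_sum _ _ _) _.
  by apply: ler_sum => k _; rewrite normrM.
(* For fixed [k], the sum of row [k] of [B] is at most the sum over all rows. *)
rewrite exchange_big mulr_suml; apply: ler_sum => k _ /=.
rewrite -mulr_sumr ler_wpM2l// /mxnorm1 [leRHS](bigD1 k)//= lerDl.
by apply: sumr_ge0 => l _; apply: sumr_ge0.
Qed.

Lemma eigenvalue_mxnorm1 n (A : 'M[K]_n) (a : K) :
  eigenvalue A a -> `|a| <= mxnorm1 A.
Proof.
move=> /eigenvalueP[v vA v0].
have v_gt0 : 0 < mxnorm1 v by rewrite lt_def mxnorm1_eq0 v0 mxnorm1_ge0.
by rewrite -(ler_pM2l v_gt0) mulrC -mxnorm1Z -vA mxnorm1M.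
Qed.

End EntrySumNorm.

(** Each factor [J] moves the support one diagonal further up: [J ^+ k] vanishes at all (i, j) with
    j < i + k, which for k = n + 1 is every entry. *)
Lemma jordan0_nilp (K : fieldType) n : jordan0 K n.+1 ^+ n.+1 = 0.
Proof.
have JX k (i j : 'I_n.+1) : (j < i + k)%N -> (jordan0 K n.+1 ^+ k) i j = 0.
  elim: k i j => [|k IHk] i j ltj.
    by rewrite expr0 mxE -val_eqE /= gtn_eqF// -[ltnRHS]addn0.
  rewrite exprS -mulmxE mxE big1// => l _; rewrite mxE.
  case: eqP => [li|_]; last by rewrite mul0r.
  by rewrite IHk ?mulr0// li addSnnS.
apply/matrixP => i j; rewrite JX ?mxE//.
by rewrite (leq_trans (ltn_ord j))// leq_addl.
Qed.

(** * The eigenvalue bound for commutator perturbations of a nilpotent matrix *)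

Section CommutatorPerturbation.
Variables (K : numFieldType) (n : nat).
Implicit Types J B E : 'M[K]_n.+1.

(** After [a *: v] is replaced by [v *m (J + eps *: E)] inside [a *: w], the first-order part is eps
    (vE - vJB + vBJ), which is zero; only the eps^2 term survives. *)
Lemma commutator_eigenvector J B E (eps a : K) (v : 'rV[K]_n.+1)
    (w := v - eps *: (v *m B)) :
  E = J *m B - B *m J -> v *m (J + eps *: E) = a *: v ->
  w *m (a%:M - J) = - (eps ^+ 2 *: (v *m (E *m B))).
Proof.
move=> EB; rewrite mulmxDr -scalemxAr => vA.
have vEB : v *m E = v *m J *m B - v *m B *m J by rewrite EB mulmxBr !mulmxA.
have aw : a *: w = (a *: v) - eps *: ((a *: v) *m B).
  by rewrite /w scalerBr -scalemxAl !scalerA mulrC.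
rewrite mulmxBr mul_mx_scalar aw -vA /w mulmxDl mulmxBl -!scalemxAl mulmxA vEB.
move: (v *m J *m B) (v *m B *m J) (v *m J) (_ *m B) => x y z t.
by apply/rowP => j; rewrite !mxE; ring.
Qed.

Lemma eigenvalue_commutator_perturb J B (E := J *m B - B *m J) :
  J ^+ n.+1 = 0 ->
  exists2 C : K, 0 <= C & exists2 d : K, 0 < d & forall eps a : K,
    `|eps| < d -> eigenvalue (J + eps *: E) a ->
    `|a| ^+ n.+1 <= C * `|eps| ^+ 2.
Proof.
move=> Jn.
(* [L] bounds |a| once |eps| <= 1. [S a] is the cofactor in a^(n+1) - J^(n+1) = (a - J) S(a), and
   [CS] bounds its norm uniformly in such [a]. *)
pose L := mxnorm1 J + mxnorm1 E.
pose S (a : K) : 'M[K]_n.+1 := \sum_(i < n.+1) a%:M ^+ (n.+1.-1 - i) * J ^+ i.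
pose CS := \sum_(i < n.+1) L ^+ (n.+1.-1 - i) * mxnorm1 (J ^+ i).
have L0 : 0 <= L by rewrite addr_ge0 ?mxnorm1_ge0.
have CS0 : 0 <= CS.
  by apply: sumr_ge0 => i _; rewrite mulr_ge0 ?exprn_ge0 ?mxnorm1_ge0.
have B1 : 0 < mxnorm1 B + 1 by rewrite ltr_wpDl ?mxnorm1_ge0.
exists (2 * (mxnorm1 (E *m B) * CS)); first by rewrite !mulr_ge0 ?mxnorm1_ge0.
(* This threshold gives both |eps| |B| <= 1/2, so that [w] keeps at least half the norm of [v], and
   |eps| <= 1; the + 1 also keeps it well defined when B = 0. *)
exists (2 * (mxnorm1 B + 1))^-1; first by rewrite invr_gt0 mulr_gt0.
move=> eps a; rewrite -[_^-1]mul1r ltr_pdivlMr ?mulr_gt0// => eps_small ea.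
have epsB : `|eps| * mxnorm1 B <= 2^-1.
  rewrite -[leRHS]mul1r ler_pdivlMr//; apply: le_trans (ltW eps_small).
  by rewrite mulrA (mulrC _ 2) -mulrA mulrCA !ler_wpM2l// lerDl.
have eps1 : `|eps| <= 1.
  apply: le_trans (ltW eps_small); rewrite ler_peMr// mulrDr mulr1.
  by rewrite ler_wpDl ?mulr_ge0 ?mxnorm1_ge0// ler1n.
have aL : `|a| <= L.
  apply: le_trans (eigenvalue_mxnorm1 ea) (le_trans (mxnorm1D _ _) _).
  by rewrite mxnorm1Z lerD2l ler_piMl ?mxnorm1_ge0.
have SCS : mxnorm1 (S a) <= CS.
  apply: le_trans (mxnorm1_sum _) _; apply: ler_sum => i _.
  rewrite -rmorphXn/= -mulmxE mul_scalar_mx mxnorm1Z normrX.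
  by rewrite ler_wpM2r ?mxnorm1_ge0// lerXn2r ?nnegrE.
have /eigenvalueP[v vA v0] := ea.
pose w := v - eps *: (v *m B).
have v_gt0 : 0 < mxnorm1 v by rewrite lt_def mxnorm1_eq0 v0 mxnorm1_ge0.
have vw : mxnorm1 v <= 2 * mxnorm1 w.
  have : mxnorm1 v <= mxnorm1 w + mxnorm1 v * 2^-1.
    rewrite -{1}(subrK (eps *: (v *m B)) v).
    apply: le_trans (mxnorm1D _ _) _; rewrite lerD2l mxnorm1Z.
    apply: (@le_trans _ _ (`|eps| * (mxnorm1 v * mxnorm1 B))).
      by rewrite ler_wpM2l// mxnorm1M.
    by rewrite mulrCA ler_wpM2l// ltW.
  rewrite -lerBlDr -{1}(mulr1 (mxnorm1 v)) -mulrBr.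
  have -> : 1 - 2^-1 = 2^-1 :> K by rewrite {1}[1 in LHS](splitr 1) mul1r addrK.
  by rewrite ler_pdivrMr// mulrC.
have w_gt0 : 0 < mxnorm1 w.
  by rewrite -(pmulr_rgt0 _ (ltr0n _ 2)) (lt_le_trans v_gt0).
(* Multiply the identity for w (a - J) by [S a] on the right; [J] and the scalar matrix commute, and
   the power of [J] vanishes. *)
have wS : a ^+ n.+1 *: w = - (eps ^+ 2 *: (v *m (E *m B))) *m S a.
  rewrite -(commutator_eigenvector erefl vA) -mulmxA mulmxE -subrXX_comm; last first.
    by rewrite /GRing.comm -!mulmxE scalar_mxC.
  by rewrite Jn subr0 -rmorphXn/= mul_mx_scalar.
rewrite -(ler_pM2r w_gt0) -normrX -mxnorm1Z wS.
apply: le_trans (mxnorm1M _ _) _.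
rewrite -scalerN mxnorm1Z -scaleN1r mxnorm1Z normrN1 mul1r normrX.
apply: le_trans (ler_wpM2l _ SCS) _.
  by rewrite mulr_ge0 ?mxnorm1_ge0 ?exprn_ge0.
have -> : 2 * (mxnorm1 (E *m B) * CS) * `|eps| ^+ 2 * mxnorm1 w =
  `|eps| ^+ 2 * ((2 * mxnorm1 w) * mxnorm1 (E *m B) * CS).
  by ring.
rewrite -[leLHS]mulrA ler_wpM2l ?exprn_ge0// ler_wpM2r//.
by apply: le_trans (mxnorm1M _ _) _; rewrite ler_wpM2r ?mxnorm1_ge0.
Qed.

End CommutatorPerturbation.

(** * Commutators with the Jordan block and sums along subdiagonals *)

Lemma diag_sum_rec (V : nmodType) n (e b : nat -> nat -> V) :
  (forall i j, (i < n)%N -> (j < n)%N ->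
     b i.+1 j = e i j + (if j is j'.+1 then b i j' else 0)) ->
  forall k s, (k + s < n)%N ->
    \sum_(t < s.+1) e (k + t)%N t = b (k + s).+1 s.
Proof.
(* Along the diagonal i - j = k, e(i, j) = b(i+1, j) - b(i, j-1) telescopes; the lower boundary term
   is 0 because column -1 of [b] counts as zero. *)
move=> be k; elim=> [|s IHs] ks.
  by rewrite big_ord1 /= be ?addr0// (leq_trans _ ks)// ltnS leq0n.
have ks' : (k + s < n)%N by rewrite (leq_trans _ ks)// addnS.
have sn : (s.+1 < n)%N by rewrite (leq_ltn_trans _ ks)// leq_addl.
by rewrite big_ord_recr /= IHs// [RHS]be// addnS addrC.
Qed.

(** Left multiplication by J shifts rows up, right multiplication shifts columns right. The boundary
    tests are explicit because [inord] would wrap an out-of-range index to 0. *)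
Lemma jordan0_commE (K : fieldType) n (B : 'M[K]_n.+1) (i j : nat) :
  (i < n.+1)%N -> (j < n.+1)%N ->
  (jordan0 K n.+1 *m B - B *m jordan0 K n.+1) (inord i) (inord j) =
  (if (i.+1 < n.+1)%N then B (inord i.+1) (inord j) else 0) -
  (if j is j'.+1 then B (inord i) (inord j') else 0).
Proof.
move=> ilt jlt; rewrite !mxE; congr (_ - _).
- case: ltnP => ib.
    rewrite (bigD1 (inord i.+1))//= big1 ?addr0 => [|l /negPf li].
      by rewrite mxE !inordK// eqxx mul1r.
    rewrite mxE inordK// -[_ == _]/(nat_of_ord l == i.+1).
    by rewrite -(inordK ib) val_eqE li mul0r.
  rewrite big1// => l _; rewrite mxE inordK// ltn_eqF ?mul0r//.
  exact: leq_trans (ltn_ord l) ib.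
- case: j jlt => [|j'] jlt.
    by rewrite big1// => l _; rewrite mxE inordK// mulr0.
  rewrite (bigD1 (inord j'))//= big1 ?addr0 => [|l /negPf li].
    by rewrite mxE !inordK// ?eqxx ?mulr1// ltnW.
  by rewrite mxE inordK// eqSS eq_sym -{1}(inordK (ltnW jlt)) val_eqE li mulr0.
Qed.

Lemma subdiag_sumE (K : fieldType) n (E : 'M[K]_n.+1) k : (k <= n)%N ->
  subdiag_sum E k = \sum_(t < (n - k).+1) E (inord (k + t)) (inord t).
Proof.
move=> kn; rewrite /subdiag_sum big_add1 /= big_mkord subSn//.
by apply: eq_bigr => t _; rewrite /entry /= addnC.
Qed.

(** Solves the recursion of [diag_sum_rec] with row 0 set to zero: the value at (i, j) sums [e] up
    the diagonal starting from (i-1, j). *)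
Fixpoint diag_primitive (V : nmodType) (e : nat -> nat -> V) (i j : nat) : V :=
  if i is i'.+1 then
    e i' j + (if j is j'.+1 then diag_primitive e i' j' else 0)
  else 0.

Lemma jordan0_commP (K : fieldType) n (E : 'M[K]_n.+1) :
  (exists B, E = jordan0 K n.+1 *m B - B *m jordan0 K n.+1) <->
  (forall k, (k <= n)%N -> subdiag_sum E k = 0).
Proof.
split=> [[B ->] k kn | E0].
  (* Row [n.+1] of [b] is zero, so the recursion also holds for the last row. *)
  pose b i j := if (i < n.+1)%N then B (inord i) (inord j) else 0.
  rewrite subdiag_sumE// (@diag_sum_rec _ n.+1 (fun i j =>
    (jordan0 K n.+1 *m B - B *m jordan0 K n.+1) (inord i) (inord j)) b).
  - by rewrite /b subnKC// ltnn.
  - move=> i j ilt jlt; rewrite jordan0_commE// /b ilt.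
    by rewrite subrK.
  - by rewrite subnKC.
pose e i j := E (inord i) (inord j).
pose b := diag_primitive e.
exists (\matrix_(i, j) b i j); apply/matrixP => p q.
rewrite -[p]inord_val -[q]inord_val jordan0_commE//.
rewrite -[E _ _]/(e p q).
set c := (if (p.+1 < _)%N then _ else _).
(* Only the last row p = n needs an argument: there [c] is 0, while [b n.+1 q] is the full sum over
   subdiagonal n - q, which vanishes by hypothesis. *)
have -> : c = b p.+1 q.
  rewrite /c; case: ltnP => ib; first by rewrite mxE !inordK.
  have {ib} -> : p = n :> nat by apply/eqP; rewrite eqn_leq -ltnS ltn_ord.
  have jn : (q <= n)%N by rewrite -ltnS.
  have := E0 _ (leq_subr q n); rewrite subdiag_sumE ?leq_subr// subKn//.
  by rewrite (@diag_sum_rec _ n.+1 e b) ?subnK.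
rewrite /b /=; case: (nat_of_ord q) (ltn_ord q) => [|q'] jlt.
  by rewrite addr0 subr0.
by rewrite mxE !inordK ?addrK// ltnW.
Qed.

(** * Passage from complex norms to real moduli, and the theorem *)

Lemma cmodE (R : realType) (z : R[i]) : `|z| = (cmod z)%:C.
Proof. by rewrite /cmod normc_def. Qed.

Lemma cmod_ge0 (R : realType) (z : R[i]) : 0 <= cmod z.
Proof. by rewrite -lecR -cmodE; exact: normr_ge0. Qed.

Theorem theorem8p1 (R : realType) (m : nat) (n := m.+1) (J := jordan0 R[i] n)
    (E : 'M[R[i]]_n) :
  ((exists B : 'M[R[i]]_n, E = J *m B - B *m J) <->
     (forall k, (k <= n - 1)%N -> subdiag_sum E k = 0))
  /\
  ((exists B : 'M[R[i]]_n, E = J *m B - B *m J) ->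
   \sum_(1 <= r < n) (-1) ^+ r * entry E n r.+1 * entry E r 1 != 0 ->
   forall lambda : R[i] -> R[i],
     (\forall eps \near (0 : R[i]^o)^', eigenvalue (J + eps *: E) (lambda eps)) ->
     (fun eps : R[i] => cmod (lambda eps - 0)) =O_ ((0 : R[i]^o)^')
       (fun eps => cmod eps `^ (2%:R / n%:R))).
Proof.
split; first by rewrite subn1; exact: jordan0_commP.
move=> [B EB] _ lambda eig.
have [C C0 [d d0 bound]] :=
  eigenvalue_commutator_perturb B (jordan0_nilp R[i] m).
(* A nonnegative element of [R[i]] is real, so the bound can be read in [R]. *)
have CRe : C = (complex.Re C)%:C by rewrite RRe_real// ger0_real.
move: C0 bound; rewrite CRe lecR; move: (complex.Re C) => c c0 bound.
(* This is the n-th root of the constant in |lambda|^n <= c |eps|^2; the + 1 makes it strictly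
   positive even if c = 0. *)
apply/eqO_exP; exists ((c + 1) `^ n%:R^-1).
  by rewrite powR_gt0// ltr_wpDl.
near=> eps.
have eps_small : `|eps| < d by near: eps; exact: (@dnbhs0_lt _ R[i]^o).
have : eigenvalue (J + eps *: E) (lambda eps) by near: eps.
rewrite EB => /(bound _ _ eps_small).
rewrite !cmodE -!rmorphXn -rmorphM lecR => le_cmod.
rewrite subr0 !ger0_norm ?powR_ge0 ?cmod_ge0// powRrM powR_mulrn ?cmod_ge0//.
rewrite -powRM ?exprn_ge0 ?cmod_ge0 ?addr_ge0//.
(* Write |lambda| as (|lambda|^n)^(1/n), so that monotonicity of x^(1/n) reduces the goal to the
   bound on n-th powers. *)
rewrite -[leLHS]powRr1 ?cmod_ge0//.
rewrite -[X in _ `^ X <= _](@divff _ (n%:R : R)) ?pnatr_eq0//.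
rewrite powRrM powR_mulrn ?cmod_ge0// ge0_ler_powR ?nnegrE ?invr_ge0//.
- by rewrite exprn_ge0 ?cmod_ge0.
- by rewrite mulr_ge0 ?addr_ge0 ?exprn_ge0 ?cmod_ge0.
- by rewrite (le_trans le_cmod)// ler_wpM2r ?exprn_ge0 ?cmod_ge0// lerDl.
Unshelve. all: by end_near.
Qed.
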